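(* Let $\Omega$ and $\Delta$ be two locally compact Hausdorff spaces. Let $E$ and $F$ be an essential Banach $C_0(\Omega)$-module and an essential Banach $C_0(\Delta)$-module respectively, and let $\theta:E\to F$ be a $\mathbb{C}$-linear map (not assumed to be bounded). Suppose that $\sigma:\Delta_\theta\to\Omega$ is an injection satisfying $\tilde\theta(e\cdot\varphi)(\nu)=\tilde\theta(e)(\nu)\,\varphi(\sigma(\nu))$ for all $e\in E$, $\varphi\in C_0(\Omega)$, $\nu\in\Delta_\theta$. Then there exist a finite subset $T\subseteq\Delta$ and $\kappa>0$ such that $$\sup_{\nu\in\Delta\setminus T}\|\tilde\theta(e)(\nu)\|\le\kappa\|e\|\qquad(e\in E).$$
   Context: Modules are right modules. A Banach $C_0(\Delta)$-module $F$ is essential if $F\cdot C_0(\Delta)$ has dense linear span; it is then regarded as a unital Banach $C(\Delta_\infty)$-module, where $\Delta_\infty$ is the one-point compactification of $\Delta$. For $\nu\in\Delta$, $K^F_\nu:=\overline{F\cdot\{\varphi\in C(\Delta_\infty):\varphi(\nu)=0\}}$, and the fibre of $F$ at $\nu$ is the Banach space $\Xi^F_\nu:=F/K^F_\nu$ (quotient norm). For a linear map $\theta:E\to F$ and $e\in E$, $\tilde\theta(e)(\nu):=\theta(e)+K^F_\nu\in\Xi^F_\nu$. $\Delta_\theta:=\Delta\setminus\mathfrak{Z}_\theta$, where $\mathfrak{Z}_\theta:=\{\nu\in\Delta:\tilde\theta(e)(\nu)=0\text{ for all }e\in E\}$. Convention: $\sup\emptyset=0$. *)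

(* Defs.v *)
From HB Require Import structures.
From mathcomp Require Import all_boot all_order all_algebra.
From mathcomp Require Import all_classical all_reals all_analysis.
From mathcomp Require Import complex.
Set Implicit Arguments.
Unset Strict Implicit.
Unset Printing Implicit Defensive.
Import Order.TTheory GRing.Theory Num.Theory.
Import numFieldNormedType.Exports.
Local Open Scope classical_set_scope.
Local Open Scope ring_scope.

(* The norm of a normed module over R[i] takes its values in R[i] (in the
   nonnegative reals); cnorm is the same number as an element of R. *)
Definition cnorm (R : realType) (V : normedModType R[i]) (x : V) : R :=
  complex.Re `|x|.

Section cnorm_theory.
Variables (R : realType) (V : normedModType R[i]).
Implicit Types (x y : V) (a : R[i]).

Lemma cnormE x : (cnorm x)%:C%C = `|x|.
Proof. by apply: RRe_real; exact: normr_real. Qed.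

Lemma cnorm_ge0 x : 0 <= cnorm x.
Proof. by rewrite -ler0c cnormE. Qed.

Lemma cnormD x y : cnorm (x + y) <= cnorm x + cnorm y.
Proof. by rewrite -lecR rmorphD /= !cnormE ler_normD. Qed.

Lemma cnormZ a x : cnorm (a *: x) = cnorm (a : R[i]^o) * cnorm x.
Proof. by apply: complexI; rewrite /= rmorphM /= !cnormE normrZ. Qed.

End cnorm_theory.

Section C0.
Variables (R : realType) (X : topologicalType).

Definition vanishes_at_infinity (f : X -> R[i]^o) : Prop :=
  forall eps : R, 0 < eps ->
    exists2 K : set X, compact K & forall x, ~ K x -> cnorm (f x) < eps.

Definition C0_pred : {pred X -> R[i]^o} :=
  fun f => `[< continuous f /\ vanishes_at_infinity f >].

Lemma C0_predP (f : X -> R[i]^o) :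
  reflect (continuous f /\ vanishes_at_infinity f) (f \in C0_pred).
Proof. exact: asboolP. Qed.

Lemma C0_submod_closed : submod_closed C0_pred.
Proof.
split.
  apply/C0_predP; split; first exact: cst_continuous.
  move=> eps eps0; exists set0; first exact: compact0.
  by move=> x _; rewrite /cnorm normr0.
move=> a f g /C0_predP[cf vf] /C0_predP[cg vg]; apply/C0_predP; split.
  by move=> x; apply: cvgD; [apply: cvgZl_tmp; exact: cf|exact: cg].
move=> eps eps0.
have a0 : 0 < cnorm (a : R[i]^o) + 1 by rewrite ltr_wpDl ?cnorm_ge0.
have e2 : 0 < eps / 2 by rewrite divr_gt0.
have [K cK Kf] := vf _ (divr_gt0 e2 a0).
have [L cL Lg] := vg _ e2.
exists (K `|` L); first exact: compactU.
move=> x /not_orP[/Kf fx /Lg gx].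
apply: (le_lt_trans (cnormD _ _)); rewrite [ltRHS]splitr.
apply: ler_ltD => //; rewrite cnormZ.
move: fx; rewrite ltr_pdivlMr// => /ltW; apply: le_trans.
by rewrite mulrC ler_wpM2l ?cnorm_ge0// lerDl.
Qed.

HB.instance Definition _ :=
  GRing.isSubmodClosed.Build _ _ C0_pred C0_submod_closed.

Record C0 := MkC0 { C0_fun :> X -> R[i]^o ; _ : C0_fun \in C0_pred }.

HB.instance Definition _ := [isSub for C0_fun].
HB.instance Definition _ := [Choice of C0 by <:].
#[warnings="-redundant-canonical-projection"]
HB.instance Definition _ := [SubChoice_isSubLmodule of C0 by <:].

Lemma C0_mul_subproof (f g : C0) : (fun x => f x * g x) \in C0_pred.
Proof.
have /C0_predP[cf vf] := valP f; have /C0_predP[cg vg] := valP g.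
apply/C0_predP; split; first by move=> x; apply: cvgM; [exact: cf|exact: cg].
move=> eps eps0; have [K cK Kf] := vf _ eps0; have [L cL Lg] := vg _ ltr01.
exists (K `|` L); first exact: compactU.
move=> x /not_orP[/Kf fx /Lg gx].
rewrite (@cnormZ _ R[i]^o) -[ltRHS]mulr1.
by rewrite ltr_pM ?cnorm_ge0.
Qed.

Definition C0_mul (f g : C0) : C0 := MkC0 (C0_mul_subproof f g).

Definition C0_norm (f : C0) : R := sup [set cnorm (f x) | x in [set: X]].

Lemma C0_part_subproof
    (f : continuousType (one_point_compactification X) R[i]^o) :
  (fun x => f (Some x) - f None) \in C0_pred.
Proof.
apply/C0_predP; split.
  move=> x; apply: cvgB; last exact: cvg_cst.
  exact: (@cts_fun _ _ f (Some x)).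
move=> eps eps0; have epsC : 0 < (eps%:C%C : R[i]) by rewrite ltcR.
have fN : f x @[x --> (None : one_point_compactification X)] --> f None.
  exact: (@cts_fun _ _ f None).
have [K [cK _] KP] := @cvgr_dist_lt _ _ _ _ _ _ _ fN _ epsC.
exists K => // x Kx; rewrite -ltcR cnormE distrC.
by apply: (KP (Some x)); left; exists x.
Qed.

(* The component in C_0(X) of a function in C(X_oo) = C_0(X) (+) C. *)
Definition C0_part
    (f : continuousType (one_point_compactification X) R[i]^o) : C0 :=
  MkC0 (C0_part_subproof f).

End C0.
Arguments C0 : clear implicits.

Definition lin_span (R : realType) (V : lmodType R[i]) (A : set V) : set V :=
  [set v | exists n (c : 'I_n -> R[i]) (x : 'I_n -> V),
     (forall i, A (x i)) /\ v = \sum_(i < n) c i *: x i].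

Section C0_modules.
Variables (R : realType) (X : topologicalType).
Variables (F : completeNormedModType R[i]) (act : F -> C0 R X -> F).

(* The action is bounded by an arbitrary constant, so that both usual
   conventions (contractive or merely bounded action) are covered. *)
Record banach_C0_module : Prop := BanachC0Module {
  act_linearl : forall (phi : C0 R X), linear (act^~ phi) ;
  act_linearr : forall (f : F), linear (act f) ;
  act_actM : forall (f : F) (phi psi : C0 R X),
    act (act f phi) psi = act f (C0_mul phi psi) ;
  act_bounded : exists M : R, forall (f : F) (phi : C0 R X),
    cnorm (act f phi) <= M * cnorm f * C0_norm phi
}.

Definition essential : Prop :=
  dense (lin_span [set act f phi | f in [set: F] & phi in [set: C0 R X]]).

Definition unital_act (f : F)
    (phi : continuousType (one_point_compactification X) R[i]^o) : F :=
  phi None *: f + act f (C0_part phi).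

Definition fibre_kernel (nu : X) : set F :=
  closure [set unital_act f phi | f in [set: F] & phi in
    [set phi : continuousType (one_point_compactification X) R[i]^o
       | phi (Some nu) = 0]].

End C0_modules.

(* The elements of the quotient space V / K are the cosets of K, which are
   subsets of V; the zero of V / K is K itself. *)
Section cosets.
Variables (R : realType) (V : normedModType R[i]) (K : set V).

Definition coset (v : V) : set V := [set v + k | k in K].

Definition coset_scale (c : R[i]) (A : set V) : set V :=
  [set c *: x + k | x in A & k in K].

Definition coset_norm (A : set V) : R := inf [set cnorm x | x in A].

End cosets.

Section tilde.
Variables (R : realType) (X : topologicalType).
Variables (E F : completeNormedModType R[i]) (actF : F -> C0 R X -> F).
Variable theta : E -> F.

Definition tilde (e : E) (nu : X) : set F :=
  coset (fibre_kernel actF nu) (theta e).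

Definition zero_locus : set X :=
  [set nu | forall e : E, tilde e nu = fibre_kernel actF nu].

Definition nonzero_locus : set X := ~` zero_locus.

End tilde.

(* Supremum in [0, +oo] of a set of nonnegative numbers, with sup(set0) = 0
   (ereal_sup set0 is -oo). *)
Definition esup0 (R : realType) (A : set \bar R) : \bar R :=
  ereal_sup (0%E |` A).

(* Main.v *)
Require Import Defs.
From HB Require Import structures.
From mathcomp Require Import all_boot all_order all_algebra.
From mathcomp Require Import all_classical all_reals all_analysis.
From mathcomp Require Import complex ring lra.

(* If no finite set T and constant work, then for every n there are infinitely
   many nu in Delta_theta admitting e with |e| <= 2^-n and |tilde theta (e) nu|
   >= n. As sigma is injective, one may pick such pairs (nu_n, e_n) so that the
   points sigma(nu_n) have pairwise disjoint open neighbourhoods U_n. With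
   phi_n in C_0(Omega) supported in U_n, equal to 1 at sigma(nu_n) and bounded
   by 1, the vector e = sum_n e_n . phi_n satisfies e . phi_n = e_n . phi_n^2,
   hence tilde theta (e) and tilde theta (e_n) agree at nu_n, and the quotient
   norm gives n <= |theta e| for all n, which is absurd. That the fibre kernels
   are linear subspaces is shown with an explicit approximate unit. *)
Set Implicit Arguments.
Unset Strict Implicit.
Unset Printing Implicit Defensive.
Import Order.TTheory GRing.Theory Num.Theory.
Import numFieldNormedType.Exports.
Local Open Scope classical_set_scope.
Local Open Scope ring_scope.

(** * Topology and series through the real-valued norm [cnorm] *)

Section cnorm_extra.
Variable R : realType.

Lemma cnorm_real_complex (t : R) : cnorm (t%:C%C : R[i]^o) = `|t|.
Proof. by rewrite /cnorm normc_def /= expr0n addr0 sqrtr_sqr. Qed.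

Variable V : normedModType R[i].
Implicit Types (x y : V) (A : set V).

Lemma cnorm0 : cnorm (0 : V) = 0.
Proof. by rewrite /cnorm normr0. Qed.

Lemma cnormN x : cnorm (- x) = cnorm x.
Proof. by rewrite /cnorm normrN. Qed.

Lemma cnorm_eq0 x : cnorm x = 0 -> x = 0.
Proof. by move=> x0; apply/normr0_eq0; rewrite -cnormE x0. Qed.

Lemma cvg_cnormP (T : Type) (G : set_system T) {FG : Filter G} (f : T -> V) x :
  f @ G --> x <->
  forall eps : R, 0 < eps -> \forall t \near G, cnorm (x - f t) < eps.
Proof.
split=> [/cvgrPdist_lt fx eps eps0|fx].
  have epsC : 0 < (eps%:C%C : R[i]) by rewrite ltcR.
  by have := fx _ epsC; apply: filterS => t; rewrite -cnormE ltcR.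
apply/cvgrPdist_lt => eps eps0.
(* A positive element of [R[i]] is real, so [eps] may be replaced by its real part. *)
have epsE : eps = (complex.Re eps)%:C%C by rewrite RRe_real// gtr0_real.
have {}eps0 : 0 < complex.Re eps by rewrite -ltcR -epsE.
by apply: filterS (fx _ eps0) => t; rewrite epsE -cnormE ltcR.
Qed.

Lemma closure_cnorm A x :
  closure A x <-> forall eps : R, 0 < eps -> exists2 a, A a & cnorm (x - a) < eps.
Proof.
split=> [Ax eps eps0|Ax B].
  have /Ax[a [Aa xa]] : nbhs x [set a | cnorm (x - a) < eps].
    by move: (@cvg_id V (nbhs x)) => /cvg_cnormP; exact.
  by exists a.
rewrite -nbhs_ballE => -[e /= e0]; rewrite -ball_normE => eB.
have eE : e = (complex.Re e)%:C%C by rewrite RRe_real// gtr0_real.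
have {}e0 : 0 < complex.Re e by rewrite -ltcR -eE.
have [a Aa xa] := Ax _ e0.
by exists a; split => //; apply: eB; rewrite /= eE -cnormE ltcR.
Qed.

Lemma cnorm_continuous : continuous (@cnorm R V).
Proof.
move=> x; apply/cvgrPdist_lt => eps eps0.
move: (@cvg_id V (nbhs x)) => /cvg_cnormP/(_ _ eps0); apply: filterS => y.
have sub (u v : V) : cnorm u - cnorm v <= cnorm (u - v).
  by rewrite lerBlDr -{1}(subrK v u) cnormD.
have : cnorm y - cnorm x <= cnorm (x - y) by rewrite -(cnormN (x - y)) opprB sub.
move=> yx xy; rewrite (le_lt_trans _ xy)// ler_norml sub lerNl opprB.
by rewrite yx.
Qed.

End cnorm_extra.

Lemma real_complex_continuous (R : realType) :
  continuous (fun t : R => t%:C%C : R[i]^o).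
Proof.
move=> t; apply/cvg_cnormP => eps eps0.
move: (@cvg_id R (nbhs t)) => /cvgrPdist_lt/(_ _ eps0); apply: filterS => u.
by rewrite -(raddfB (real_complex R)) /= cnorm_real_complex.
Qed.

(** By completeness: the blocks of the series are dominated by those of a geometric series of ratio
    1/2, hence satisfy the Cauchy criterion. *)
Lemma geometric_cvg_series (R : realType) (V : completeNormedModType R[i])
    (u : nat -> V) (C : R) :
  (forall n, cnorm (u n) <= C * 2^-1 ^+ n) -> cvgn (series u).
Proof.
move=> uC; apply/cauchy_cvgP/cauchy_seriesP => e e0.
have eE : e = (complex.Re e)%:C%C by rewrite RRe_real// gtr0_real.
have {}e0 : 0 < complex.Re e by rewrite -ltcR -eE.
have : cvgn (series (geometric C (2^-1 : R))).
  apply: is_cvg_geometric_series.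
  by rewrite gtr0_norm ?invr_gt0// invf_lt1// ltr1n.
move=> /cauchy_cvgP/cauchy_seriesP/(_ _ e0); apply: filterS => -[m n] /= mn.
rewrite eE -cnormE ltcR; apply: le_lt_trans mn.
apply: (@le_trans _ _ (\sum_(m <= k < n) cnorm (u k))).
  elim/big_rec2 : _ => [|k y1 y2 _ IH]; first by rewrite cnorm0.
  by apply: le_trans (cnormD _ _) _; rewrite lerD2l.
apply: le_trans (ler_norm _); apply: ler_sum => k _.
exact: uC.
Qed.

(** * Bump functions and the selection of points with disjoint neighbourhoods *)

Section disjoint_selection.
Variables (R : realType) (X : topologicalType).
Hypotheses (hausX : hausdorff_space X) (lcX : locally_compact [set: X]).

Lemma urysohn_point (x : X) (B : set X) : closed B -> ~ B x ->
  exists f : X -> R, [/\ continuous f, forall y, 0 <= f y <= 1, f x = 0 &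
    forall y, B y -> f y = 1].
Proof.
move=> cB Bx.
have /(uniform_separatorP (R := R))[f [cf f01 fx fB]] :=
  @locally_compact_completely_regular X R lcX hausX x B cB Bx.
exists f; split => //.
- by move=> y; have := f01 (f y) (ex_intro2 _ _ y I erefl); rewrite /= in_itv.
- by apply: fx; exists x.
- by move=> y By; apply: fB; exists y.
Qed.

(** The bump is [1 - f], where [f] separates [x] from the complement of [U] intersected with the
    interior of a compact neighbourhood [K]; cutting down to [K] makes it vanish at infinity. *)
Lemma C0_bump (x : X) (U : set X) : open U -> U x ->
  exists phi : C0 R X, [/\ phi x = 1, forall y, ~ U y -> phi y = 0 &
    forall y, cnorm (phi y) <= 1].
Proof.
move=> oU Ux.
have [K + [cK _]] := @lcX x I; rewrite withinET => xK.
have [||f [cf f01 fx fU]] := @urysohn_point x (~` (U `&` K°)).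
- by apply: open_closedC; apply: openI => //; exact: open_interior.
- by apply.
have phiC0 : (fun y => (1 - f y)%:C%C : R[i]^o) \in @C0_pred R X.
  apply/C0_predP; split.
    move=> y; apply: (@cvg_comp _ _ _ (fun y => 1 - f y) (fun t => t%:C%C : R[i]^o)).
      by apply: cvgB; [exact: cvg_cst|exact: cf].
    exact: real_complex_continuous.
  move=> eps eps0; exists K => // y Ky.
  by rewrite fU ?subrr ?cnorm0// => -[_ /interior_subset].
exists (MkC0 phiC0); split => /= [|y Uy|y].
- by rewrite fx subr0.
- by rewrite fU ?subrr// => -[].
- rewrite cnorm_real_complex; have /andP[? ?] := f01 y.
  by rewrite ler_norml; apply/andP; split; lra.
Qed.

(** Induction on a shrinking open set [O] that stays big, in the sense that infinitely many indices
    of every [J n] are sent into it. Each step splits off a point with a neighbourhood [U] and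
    continues in a big open subset of [O] disjoint from [U]. *)
Lemma infinite_disjoint_open (I : Type) (s : I -> X) (J : nat -> set I) :
  injective s -> (forall m n, (m <= n)%N -> J n `<=` J m) ->
  (forall n, infinite_set (J n)) ->
  exists (i : nat -> I) (U : nat -> set X),
    [/\ forall n, J n (i n), forall n, open (U n), forall n, U n (s (i n)) &
      forall m n, m != n -> U m `&` U n = set0].
Proof.
move=> s_inj J_anti J_inf.
pose big (O : set X) := open O /\ forall n, infinite_set (J n `&` s @^-1` O).
have splitO (O O1 O2 : set X) : big O -> open O1 -> open O2 ->
    O `<=` O1 `|` O2 -> big O1 \/ big O2.
  move=> [oO bO] o1 o2 O12; apply: contrapT => /not_orP[b1 b2].
  have fin O' : open O' -> ~ big O' -> exists n, finite_set (J n `&` s @^-1` O').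
    move=> oO' bO'; apply: contrapT => /forallNP fin; apply: bO'.
    by split => // n /fin.
  have [n1 f1] := fin _ o1 b1; have [n2 f2] := fin _ o2 b2.
  (* Since [J] decreases, both traces are finite from level [maxn n1 n2] on, so the trace of [O]
     would be finite there. *)
  apply: (bO (maxn n1 n2)).
  apply: (@sub_finite_set _ _ ((J n1 `&` s @^-1` O1) `|` (J n2 `&` s @^-1` O2))).
    move=> j [Jj /O12[]] Oj; [left|right]; split => //.
      by apply: J_anti Jj; rewrite leq_maxl.
    by apply: J_anti Jj; rewrite leq_maxr.
  by rewrite finite_setU.
have step n O : big O -> exists (j : I) (U O' : set X),
    [/\ J n j, open U, U (s j), U `<=` O & [/\ big O', O' `<=` O & U `&` O' = set0]].
  move=> bO; have [oO /(_ n) infO] := bO.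
  have [j [Jj Oj]] := infinite_setN0 infO.
  (* A second index is needed because the open set around [s j] may be the only big one; then [k] is
     selected instead of [j]. *)
  have [k [[Jk Ok] kj]] : ((J n `&` s @^-1` O) `\` [set j]) !=set0.
    by apply: infinite_setN0; apply: infinite_setD.
  have [||f [cf f01 fj fk]] := @urysohn_point (s j) [set s k].
  - apply: accessible_closed_set1; exact: hausdorff_accessible.
  - by move=> /s_inj/esym.
  have {}fk := fk _ erefl.
  have ltf a : open [set y | f y < a].
    by apply: open_comp (@open_lt _ a) => y _; exact: cf.
  have gtf a : open [set y | a < f y].
    by apply: open_comp (@open_gt _ a) => y _; exact: cf.
  (* The two sets overlap and cover [O], so one is big. It becomes the next open set, and the
     selected point is the one on the other side: [s j], where [f] is 0, or [s k], where [f] is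
     1. *)
  have [b1|b2] : big (O `&` [set y | 3^-1 < f y]) \/ big (O `&` [set y | f y < 2/3]).
    apply: (splitO O _ _ bO); [exact: openI|exact: openI|].
    move=> y Oy; have [|] := ltP 3^-1 (f y); first by left.
    by move=> fy; right; split => //=; lra.
  - exists j, (O `&` [set y | f y < 3^-1]), (O `&` [set y | 3^-1 < f y]).
    split=> //; [exact: openI| |].
      by split => //=; rewrite fj; lra.
    split=> //.
    by apply/seteqP; split => // y [[_ /= ?] [_ /= ?]]; lra.
  - exists k, (O `&` [set y | 2/3 < f y]), (O `&` [set y | f y < 2/3]).
    split=> //; [exact: openI| |].
      by split => //=; rewrite fk; lra.
    split=> //.
    by apply/seteqP; split => // y [[_ /= ?] [_ /= ?]]; lra.
have {}step : forall t : nat * {O | big O}, exists p : I * set X * {O | big O},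
    [/\ J t.1 p.1.1, open p.1.2, p.1.2 (s p.1.1), p.1.2 `<=` sval t.2 &
      sval p.2 `<=` sval t.2 /\ p.1.2 `&` sval p.2 = set0].
  move=> [n [W bW]]; have [j [U [W' [? ? ? ? [bW' ? ?]]]]] := step n W bW.
  by exists ((j, U), exist _ W' bW').
have [g gP] := choice step.
have bigT : big setT.
  by split=> [|n]; [exact: openT|rewrite preimage_setT setIT].
(* [st n] is the big open set left before the choice of the [n]-th point; [U n] lies in [st n] and
   is disjoint from [st n.+1]. *)
pose st := fix st n := if n is m.+1 then (g (m, st m)).2 else exist _ setT bigT.
pose i n := (g (n, st n)).1.1; pose U n := (g (n, st n)).1.2.
have stS m n : (m <= n)%N -> sval (st n) `<=` sval (st m).
  elim: n => [|n IH]; first by rewrite leqn0 => /eqP ->.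
  rewrite leq_eqVlt => /predU1P[->//|/IH]; apply: subset_trans.
  by have [_ _ _ _ []] := gP (n, st n).
have disj m n : (m < n)%N -> U m `&` U n = set0.
  move=> mn; have [_ _ _ _ [_ /= Um]] := gP (m, st m).
  have [_ _ _ /= Un _] := gP (n, st n).
  rewrite -subset0 => y [my ny]; rewrite -[set0]Um; split => //.
  by apply: (stS m.+1 n mn); exact: Un.
exists i, U; split => [n|n|n|m n].
- by have [] := gP (n, st n).
- by have [] := gP (n, st n).
- by have [] := gP (n, st n).
- by rewrite neq_ltn => /orP[|] /disj//; rewrite setIC.
Qed.

End disjoint_selection.

(** * The action of functions on the one-point compactification *)

Section unital_action.
Variables (R : realType) (X : topologicalType).
Local Notation Xoo := (one_point_compactification X).
Local Notation CXoo := (continuousType Xoo R[i]^o).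

Lemma continuousType_ex (f : Xoo -> R[i]^o) :
  continuous f -> exists g : CXoo, g =1 f.
Proof.
move=> cf; pose g : CXoo := HB.pack f (isContinuous.Build _ _ f cf).
by exists g.
Qed.

Lemma C0_norm_le (phi : C0 R X) (c : R) : 0 <= c ->
  (forall x, cnorm (phi x) <= c) -> C0_norm phi <= c.
Proof.
move=> c0 phic; rewrite /C0_norm.
have [->|/set0P ne] := eqVneq [set cnorm (phi x) | x in [set: X]] set0.
  by rewrite sup0.
by apply: ge_sup => // _ [x _ <-].
Qed.

Lemma C0_norm_ge0 (phi : C0 R X) : 0 <= C0_norm phi.
Proof.
rewrite /C0_norm; set A := [set _ | _ in _].
have [[[y Ay] ubA]|/sup_out->//] := pselect (has_sup A).
apply: (@le_trans _ _ y); last exact: ub_le_sup.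
by case: Ay => x _ <-; exact: cnorm_ge0.
Qed.

Variables (F : completeNormedModType R[i]) (act : F -> C0 R X -> F).
Hypothesis modF : banach_C0_module act.
Let actl (phi : C0 R X) : {linear F -> F} :=
  HB.pack (act^~ phi) (GRing.isLinear.Build _ _ _ _ _ (act_linearl modF phi)).
Let actr (f : F) : {linear C0 R X -> F} :=
  HB.pack (act f) (GRing.isLinear.Build _ _ _ _ _ (act_linearr modF f)).

Lemma actBl phi f g : act (f - g) phi = act f phi - act g phi.
Proof. exact: (raddfB (actl phi)). Qed.
Lemma actDl phi f g : act (f + g) phi = act f phi + act g phi.
Proof. exact: (raddfD (actl phi)). Qed.
Lemma actZl phi c f : act (c *: f) phi = c *: act f phi.
Proof. exact: (linearZZ (actl phi)). Qed.
Lemma act0l phi : act 0 phi = 0.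
Proof. exact: (raddf0 (actl phi)). Qed.
Lemma actDr f phi psi : act f (phi + psi) = act f phi + act f psi.
Proof. exact: (raddfD (actr f)). Qed.
Lemma actBr f phi psi : act f (phi - psi) = act f phi - act f psi.
Proof. exact: (raddfB (actr f)). Qed.
Lemma actZr f c phi : act f (c *: phi) = c *: act f phi.
Proof. exact: (linearZZ (actr f)). Qed.
Lemma act0r f : act f 0 = 0.
Proof. exact: (raddf0 (actr f)). Qed.
Lemma act_suml n (f : nat -> F) phi :
  act (\sum_(0 <= k < n) f k) phi = \sum_(0 <= k < n) act (f k) phi.
Proof. exact: (raddf_sum (actl phi)). Qed.

Lemma unital_actD f g p :
  unital_act act (f + g) p = unital_act act f p + unital_act act g p.
Proof. by rewrite /unital_act actDl scalerDr addrACA. Qed.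

Lemma unital_actZ c f p : unital_act act (c *: f) p = c *: unital_act act f p.
Proof. by rewrite /unital_act actZl scalerDr !scalerA mulrC. Qed.

Lemma unital_act0 p : unital_act act 0 p = 0.
Proof. by rewrite /unital_act act0l scaler0 addr0. Qed.

(** The difference enters as a function [r] with a pointwise identity, so that no algebra structure
    on [CXoo] is involved. *)
Lemma unital_actB f (p q r : CXoo) : (forall x, r x = p x - q x) ->
  unital_act act f p - unital_act act f q = unital_act act f r.
Proof.
move=> rE; rewrite /unital_act opprD addrACA -scalerBl -actBr rE.
congr (_ *: _ + act f _); apply: val_inj; apply/funext => x /=.
by rewrite !rE !fctE; ring.
Qed.

Lemma unital_actM f (p q r : CXoo) : (forall x, r x = p x * q x) ->
  unital_act act (unital_act act f p) q = unital_act act f r.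
Proof.
move=> rE; rewrite /unital_act actDl actZl act_actM // scalerDr scalerA.
(* Expansion of the product of [p] and [q], each written as its [C0_part] plus its value at
   infinity. *)
have -> : C0_part r = C0_mul (C0_part p) (C0_part q) + q None *: C0_part p +
                      p None *: C0_part q.
  apply: val_inj; apply/funext => x /=; rewrite !rE.
  rewrite !fctE.
  have regE (a b : R[i]^o) : a *: b = a * b by [].
  by rewrite !regE; ring.
rewrite !actDr !actZr rE mulrC -!addrA; congr (_ + _).
by rewrite [RHS]addrC addrA.
Qed.

Lemma unital_act_bounded : exists2 C : R, 0 < C &
  forall f (p : CXoo) c, (forall x, cnorm (p x) <= c) ->
    cnorm (unital_act act f p) <= C * c * cnorm f.
Proof.
have [M Mb] := act_bounded modF.
exists (1 + `|M| * 2); first by rewrite ltr_pwDl// mulr_ge0.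
move=> f p c pc.
have c0 : 0 <= c by apply: le_trans (pc None); exact: cnorm_ge0.
apply: le_trans (cnormD _ _) _; rewrite -mulrA mulrDl mul1r; apply: lerD.
  by rewrite cnormZ ler_wpM2r ?cnorm_ge0.
have partc : C0_norm (C0_part p) <= 2 * c.
  apply: C0_norm_le => [|x]; first by rewrite mulr_ge0.
  apply: le_trans (cnormD _ _) _; rewrite cnormN mulr_natl mulr2n.
  by apply: lerD; exact: pc.
apply: le_trans (Mb f _) _.
apply: (@le_trans _ _ (`|M| * cnorm f * C0_norm (C0_part p))).
  rewrite !ler_wpM2r ?cnorm_ge0 ?C0_norm_ge0//; exact: ler_norm.
rewrite -!mulrA ler_wpM2l//.
by rewrite mulrA [leRHS]mulrC ler_wpM2l ?cnorm_ge0.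
Qed.

(* chi = w / (w + eps^2) with w = |p|^2 + |q|^2 satisfies
   |p - p chi| = |p| eps^2 / (w + eps^2) <= eps. *)
Lemma approximate_unit (nu : Xoo) (p q : CXoo) (eps : R) : 0 < eps ->
  p nu = 0 -> q nu = 0 ->
  exists chi : CXoo, [/\ chi nu = 0,
    forall x, cnorm (p x - p x * chi x) <= eps &
    forall x, cnorm (q x - q x * chi x) <= eps].
Proof.
move=> eps0 pnu qnu.
pose w x : R := cnorm (p x) ^+ 2 + cnorm (q x) ^+ 2.
have w0 x : 0 <= w x by rewrite addr_ge0// sqr_ge0.
have we x : 0 < w x + eps ^+ 2 by rewrite ltr_wpDl// exprn_gt0.
pose g x : R := w x / (w x + eps ^+ 2).
have cw : continuous w.
  have cn (r : CXoo) : continuous (fun x => cnorm (r x) ^+ 2).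
    move=> x.
    have cr : cnorm (r y) @[y --> x] --> cnorm (r x).
      apply: (@cvg_comp _ _ _ r (@cnorm R R[i]^o)); first exact: cts_fun.
      exact: cnorm_continuous.
    exact: (cvg_comp _ _ cr (@exprn_continuous R 2 (cnorm (r x)))).
  by move=> x; exact: cvgD (cn p x) (cn q x).
have cg : continuous g.
  move=> x; have wx : w y @[y --> x] --> w x by exact: cw.
  have wex : w y + eps ^+ 2 @[y --> x] --> w x + eps ^+ 2.
    exact: cvgD wx (cvg_cst _).
  have wx0 : w x + eps ^+ 2 != 0 by rewrite gt_eqF.
  exact: cvgM wx (cvgV wx0 wex).
have [chi chiE] : exists chi : CXoo, chi =1 (fun x => (g x)%:C%C).
  apply: continuousType_ex => x.
  apply: (@cvg_comp _ _ _ g (fun t => t%:C%C : R[i]^o)); first exact: cg.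
  exact: real_complex_continuous.
have bound (z : R[i]^o) x : cnorm z ^+ 2 <= w x -> cnorm (z - z * chi x) <= eps.
  move=> zw; rewrite -{1}(mulr1 z) -mulrBr chiE.
  have -> : 1 - (g x)%:C%C = (eps ^+ 2 / (w x + eps ^+ 2))%:C%C :> R[i].
    rewrite -(rmorph1 (real_complex R)) -(rmorphB (real_complex R)); congr (_%:C%C).
    by rewrite /g; field; rewrite gt_eqF.
  rewrite (@cnormZ _ R[i]^o) cnorm_real_complex ger0_norm; last first.
    by rewrite divr_ge0 ?sqr_ge0// ltW.
  rewrite mulrA ler_pdivrMr//.
  have eps0' := ltW eps0.
  (* The three nonnegative terms add up to [eps * (w x + eps ^+ 2) - cnorm z * eps ^+ 2]. *)
  have h1 : 0 <= eps * (w x - cnorm z ^+ 2) by rewrite mulr_ge0// subr_ge0.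
  have h2 : 0 <= eps * (cnorm z - eps) ^+ 2 by rewrite mulr_ge0// sqr_ge0.
  have h3 : 0 <= eps * (cnorm z * eps) by rewrite !mulr_ge0// cnorm_ge0.
  lra.
exists chi; split => [|x|x].
- by rewrite chiE /g /w pnu qnu !cnorm0 expr0n addr0 mul0r.
- by apply: bound; rewrite lerDl sqr_ge0.
- by apply: bound; rewrite lerDr sqr_ge0.
Qed.

(** * Fibre kernels are linear subspaces *)

Lemma fibre_kernel0 nu : fibre_kernel act nu 0.
Proof.
have [p pE] := continuousType_ex (@cst_continuous Xoo R[i]^o 0).
apply: subset_closure; exists 0 => //; exists p; first exact: pE.
by rewrite unital_act0.
Qed.

Lemma fibre_kernelZ nu c x : fibre_kernel act nu x -> fibre_kernel act nu (c *: x).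
Proof.
move=> /closure_cnorm xK; apply/closure_cnorm => eps eps0.
have c0 : 0 < cnorm (c : R[i]^o) + 1 by rewrite ltr_wpDl ?cnorm_ge0.
have [_ [f _ [p pnu <-]] xf] := xK _ (divr_gt0 eps0 c0).
exists (unital_act act (c *: f) p); first by exists (c *: f) => //; exists p.
rewrite unital_actZ -scalerBr cnormZ.
move: xf; rewrite ltr_pdivlMr// mulrC mulrDl mul1r; apply: le_lt_trans.
by rewrite lerDl cnorm_ge0.
Qed.

(** The kernel is the closure of a set of products, not of its span, so a sum of two products must
    be approximated by a single one: multiplying it by an approximate unit [chi] that vanishes at
    [nu] does so. *)
Lemma fibre_kernelD nu x y : fibre_kernel act nu x -> fibre_kernel act nu y ->
  fibre_kernel act nu (x + y).
Proof.
move=> /closure_cnorm xK /closure_cnorm yK; apply/closure_cnorm => eps eps0.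
have e4 : 0 < eps / 4 by rewrite divr_gt0.
have [_ [f _ [p pnu <-]] xf] := xK _ e4; have [_ [g _ [q qnu <-]] yg] := yK _ e4.
have [C C0 Cb] := unital_act_bounded.
(* With tolerance [eps / 4] divided by this number, the two errors caused by [chi] add up to at most
   [eps / 4]; the [+ 1] keeps the divisor positive when [f] and [g] are 0. *)
have D0 : 0 < C * (cnorm f + cnorm g + 1).
  by rewrite mulr_gt0// ltr_wpDl// addr_ge0 ?cnorm_ge0.
have [chi [chinu pchi qchi]] :=
  @approximate_unit (Some nu) p q _ (divr_gt0 e4 D0) pnu qnu.
set del := eps / 4 / _ in pchi qchi.
exists (unital_act act (unital_act act f p + unital_act act g q) chi).
  by exists (unital_act act f p + unital_act act g q) => //; exists chi.
have close (h : F) (r : CXoo) : (forall z, cnorm (r z - r z * chi z) <= del) ->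
    cnorm (unital_act act h r - unital_act act (unital_act act h r) chi) <=
      C * del * cnorm h.
  move=> rchi.
  have [r1 r1E] : exists r1 : CXoo, r1 =1 (fun z => r z * chi z).
    apply: continuousType_ex => z.
    exact: cvgM (@cts_fun _ _ r z) (@cts_fun _ _ chi z).
  have [r2 r2E] : exists r2 : CXoo, r2 =1 (fun z => r z - r1 z).
    apply: continuousType_ex => z.
    exact: cvgB (@cts_fun _ _ r z) (@cts_fun _ _ r1 z).
  rewrite (unital_actM _ r1E) (unital_actB _ r2E).
  by apply: Cb => z; rewrite r2E r1E.
have := close f p pchi; have := close g q qchi.
have delE : C * del * (cnorm f + cnorm g + 1) = eps / 4.
  by rewrite /del mulrAC mulrC divfK// gt_eqF.
have Cdel : 0 <= C * del by rewrite ltW// mulr_gt0// divr_gt0.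
rewrite unital_actD.
set a := unital_act act f p in xf *; set b := unital_act act g q in yg *.
set a' := unital_act act a chi; set b' := unital_act act b chi.
move=> bb aa.
have -> : x + y - (a' + b') = (x - a) + (y - b) + (a - a') + (b - b').
  by rewrite -[RHS]addrA [x - a + _]addrACA [a - a' + _]addrACA -!opprD addrA subrK.
apply: le_lt_trans (cnormD _ _) _.
have := cnormD (x - a + (y - b)) (a - a'); have := cnormD (x - a) (y - b).
lra.
Qed.

End unital_action.

(** * Cosets and the quotient norm *)

Section cosets.
Variables (R : realType) (V : normedModType R[i]) (K : set V).
Hypotheses (K0 : K 0) (KD : forall x y, K x -> K y -> K (x + y)).
Hypothesis KZ : forall (c : R[i]) x, K x -> K (c *: x).

Lemma coset_refl v : coset K v v.
Proof. by exists 0 => //; rewrite addr0. Qed.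

Lemma coset_eq v w : K (v - w) -> coset K v = coset K w.
Proof.
have sub a b : K (a - b) -> coset K a `<=` coset K b.
  move=> Kab _ [k Kk <-]; exists (a - b + k); first exact: KD.
  by rewrite addrA (addrC b) subrK.
move=> Kvw; apply/seteqP; split; apply: sub => //.
by rewrite -opprB -scaleN1r; exact: KZ.
Qed.

Lemma coset_norm_le v x : coset K v x -> coset_norm (coset K v) <= cnorm x.
Proof.
move=> vx; apply: ge_inf; last by exists x.
by exists 0 => _ [y _ <-]; exact: cnorm_ge0.
Qed.

Lemma coset_normZ_ge (c : R[i]) v : c != 0 ->
  cnorm (c : R[i]^o) * coset_norm (coset K v) <= coset_norm (coset K (c *: v)).
Proof.
move=> c0; apply: lb_le_inf.
  by exists (cnorm (c *: v)), (c *: v) => //; exact: coset_refl.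
move=> _ [_ [k Kk <-] <-].
have -> : c *: v + k = c *: (v + c^-1 *: k).
  by rewrite scalerDr scalerA divff// scale1r.
rewrite cnormZ ler_wpM2l ?cnorm_ge0//; apply: coset_norm_le.
by exists (c^-1 *: k) => //; exact: KZ.
Qed.

(** This turns the hypothesis on [sigma], at a point where the function takes the value 1, into a
    membership in the fibre kernel. *)
Lemma coset_scale1P v w : coset K w = coset_scale K 1 (coset K v) -> K (w - v).
Proof.
move=> wv; have := coset_refl w; rewrite wv => -[_ [k Kk <-] [l Kl <-]].
rewrite scale1r -(addrA v) [v + _]addrC addrK; exact: KD.
Qed.

End cosets.

(** The vector [f] is the sum of the series of [act (e n) (phi n)] with bumps [phi n] supported in
    [U n]. Disjointness kills all products [phi k * phi n] with [k != n], and boundedness of the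
    action carries this to the limit. *)
Lemma act_glue (R : realType) (X : topologicalType)
    (hausX : hausdorff_space X) (lcX : locally_compact [set: X])
    (E : completeNormedModType R[i]) (act : E -> C0 R X -> E)
    (modE : banach_C0_module act)
    (x : nat -> X) (U : nat -> set X) (e : nat -> E) :
  (forall n, open (U n)) -> (forall n, U n (x n)) ->
  (forall m n, m != n -> U m `&` U n = set0) ->
  (forall n, cnorm (e n) <= 2^-1 ^+ n) ->
  exists (f : E) (phi : nat -> C0 R X), (forall n, phi n (x n) = 1) /\
    forall n, act f (phi n) = act (act (e n) (phi n)) (phi n).
Proof.
move=> oU Ux disj en.
have [phi phiP] := choice (fun n => @C0_bump R X hausX lcX (x n) (U n) (oU n) (Ux n)).
have [M Mb] := act_bounded modE.
have cvg_e : cvgn (series (fun n => act (e n) (phi n))).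
  apply: (@geometric_cvg_series R E _ `|M|) => n.
  have phi1 : C0_norm (phi n) <= 1.
    by apply: C0_norm_le => // y; have [] := phiP n.
  apply: le_trans (Mb _ _) _.
  apply: (@le_trans _ _ (`|M| * cnorm (e n) * C0_norm (phi n))).
    by rewrite !ler_wpM2r ?cnorm_ge0 ?C0_norm_ge0//; exact: ler_norm.
  rewrite -mulrA ler_wpM2l// -[leRHS]mulr1.
  by rewrite ler_pM ?cnorm_ge0 ?C0_norm_ge0.
exists (limn (series (fun n => act (e n) (phi n)))), phi.
split=> n; first by have [] := phiP n.
set f := limn _; set g := act (e n) (phi n).
have partial N : (n < N)%N ->
    act (series (fun n => act (e n) (phi n)) N) (phi n) = act g (phi n).
  move=> nN; rewrite /series /= (act_suml modE) big_mkord.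
  rewrite (bigD1 (Ordinal nN))//= big1 ?addr0// => k kn.
  have kn' : (k : nat) != n by apply: contraNneq kn => kn; apply/eqP/val_inj.
  rewrite (act_actM modE).
  have -> : C0_mul (phi k) (phi n) = 0.
    apply: val_inj; apply/funext => y /=.
    have [_ phik _] := phiP k; have [_ phin _] := phiP n.
    have [Uk|/phik->] := pselect (U k y); last by rewrite mul0r.
    rewrite phin ?mulr0// => Un.
    by have : (U k `&` U n) y by []; rewrite disj.
  exact: act0r.
apply/eqP; rewrite -subr_eq0; apply/eqP/cnorm_eq0/eqP.
rewrite eq_le cnorm_ge0 andbT; apply/ler_addgt0Pr => eps eps0; rewrite add0r.
have D0 : 0 < `|M| * C0_norm (phi n) + 1.
  by rewrite ltr_wpDl// mulr_ge0// C0_norm_ge0.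
have /cvg_cnormP/(_ _ (divr_gt0 eps0 D0)) :
  series (fun n => act (e n) (phi n)) @ \oo --> f by [].
(* The index must be large for convergence and also exceed [n], so that the partial sum contains the
   [n]-th term. *)
move=> [N _ /(_ (maxn N n.+1))]/=; rewrite leq_maxl => /(_ isT) close.
rewrite -(partial (maxn N n.+1)) ?leq_maxr// -(actBl modE).
set d := f - _ in close *.
apply: le_trans (Mb _ _) _.
apply: (@le_trans _ _ (`|M| * cnorm d * C0_norm (phi n))).
  by rewrite !ler_wpM2r ?cnorm_ge0 ?C0_norm_ge0//; exact: ler_norm.
move: close; rewrite ltr_pdivlMr// => /ltW; apply: le_trans.
by rewrite mulrAC [leRHS]mulrC ler_wpM2r ?cnorm_ge0// lerDl.
Qed.

(** * The bound on the fibre norms outside a finite set *)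

Theorem proposition3p5 (R : realType) (Omega Delta : topologicalType)
  (hausOmega : hausdorff_space Omega)
  (lcOmega : locally_compact [set: Omega])
  (hausDelta : hausdorff_space Delta)
  (lcDelta : locally_compact [set: Delta])
  (E F : completeNormedModType R[i])
  (actE : E -> C0 R Omega -> E) (actF : F -> C0 R Delta -> F)
  (modE : banach_C0_module actE) (essE : essential actE)
  (modF : banach_C0_module actF) (essF : essential actF)
  (theta : {linear E -> F})
  (sigma : nonzero_locus actF theta -> Omega)
  (sigma_inj : injective sigma)
  (sigmaP : forall (e : E) (phi : C0 R Omega) (nu : nonzero_locus actF theta),
    tilde actF theta (actE e phi) (set_val nu) =
    coset_scale (fibre_kernel actF (set_val nu)) (phi (sigma nu))
      (tilde actF theta e (set_val nu))) :
  exists T : set Delta, finite_set T /\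
  exists kappa : R, 0 < kappa /\
  forall e : E,
    (esup0 [set (coset_norm (tilde actF theta e nu))%:E | nu in ~` T]
       <= (kappa * cnorm e)%:E)%E.
Proof.
pose K := fibre_kernel actF.
have K0 nu : K nu 0 by exact: fibre_kernel0.
have KD nu x y : K nu x -> K nu y -> K nu (x + y) by exact: fibre_kernelD.
have KZ nu (c : R[i]) x : K nu x -> K nu (c *: x) by exact: fibre_kernelZ.
(* Points that are bad at level [n]. The radius [2^-1 ^+ n] makes the selected vectors summable, and
   both conditions tighten with [n], so [J] decreases. *)
pose J n : set (nonzero_locus actF theta) := [set nu | exists2 e : E,
  cnorm e <= 2^-1 ^+ n & n%:R <= coset_norm (tilde actF theta e (set_val nu))].
have J_anti m n : (m <= n)%N -> J n `<=` J m.
  move=> mn nu [e e1 e2]; exists e.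
    by apply: le_trans e1 _; rewrite ler_wiXn2l// invf_le1// ler1n.
  by apply: le_trans e2; rewrite ler_nat.
have [J_inf|/existsNP[n /contrapT Jfin]] := pselect (forall n, infinite_set (J n)).
  have [i [U [Ji oU Ui disj]]] :=
    @infinite_disjoint_open R Omega hausOmega lcOmega _ _ _ sigma_inj J_anti J_inf.
  have [e eP] := choice (fun n =>
    let: ex_intro2 e e1 e2 := Ji n in ex_intro _ e (conj e1 e2)).
  have [f [phi [phi1 fphi]]] := @act_glue R Omega hausOmega lcOmega E actE modE
    (sigma \o i) U e oU Ui disj (fun n => (eP n).1).
  have large n : n%:R <= cnorm (theta f).
    have [_ en] := eP n; apply: le_trans en _.
    (* As [phi n] is 1 at the image of the selected point under [sigma], acting by it leaves the
       fibre value there unchanged. *)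
    have Kphi g : K (set_val (i n)) (theta (actE g (phi n)) - theta g).
      apply: coset_scale1P => //; first exact: KD.
      by have := sigmaP g (phi n) (i n); rewrite phi1.
    (* In this fibre [e n] agrees with its image under two actions of [phi n], which equals
       [actE f (phi n)] and so agrees with [f]. *)
    have -> : tilde actF theta (e n) (set_val (i n)) = tilde actF theta f (set_val (i n)).
      have eqK := coset_eq (KD (set_val (i n))) (KZ (set_val (i n))).
      rewrite /tilde -(eqK _ _ (Kphi f)) fphi (eqK _ _ (Kphi _)).
      by rewrite (eqK _ _ (Kphi _)).
    exact: coset_norm_le (coset_refl (K0 _) _).
  have := large (Num.truncn (cnorm (theta f))).+1.
  by rewrite leNgt truncnS_gt.
exists (set_val @` J n); split; first exact: finite_image.
(* Rescaling to norm [2^-1 ^+ n] produces the factor [n%:R * 2 ^+ n]; the [+ 1] gives positivity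
   even for [n = 0]. *)
exists (n%:R * 2 ^+ n + 1); split.
  by rewrite ltr_wpDl// mulr_ge0// exprn_ge0.
move=> e; apply: ge_ereal_sup => _ [->|[nu nuT <-]].
  by rewrite lee_fin mulr_ge0 ?cnorm_ge0// addr_ge0// mulr_ge0// exprn_ge0.
rewrite lee_fin.
(* The finite set contains only points of the nonzero locus; elsewhere the coset is the kernel
   itself, of norm 0. *)
have [nu0|nu1] := pselect (zero_locus actF theta nu).
  apply: (@le_trans _ _ 0); last first.
    by rewrite mulr_ge0 ?cnorm_ge0// addr_ge0// mulr_ge0// exprn_ge0.
  rewrite -(cnorm0 F) coset_norm_le// -/(tilde actF theta e nu) nu0.
  exact: K0.
have [e0|e0] := eqVneq (cnorm e) 0.
  rewrite e0 mulr0 (cnorm_eq0 e0) /tilde raddf0 -(cnorm0 F).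
  exact: coset_norm_le (coset_refl (K0 _) _).
have {}e0 : 0 < cnorm e by rewrite lt_def e0 cnorm_ge0.
(* The factor that brings [e] to norm exactly [2^-1 ^+ n]; as [nu] is not bad at level [n], the
   fibre norm of the rescaled vector is below [n]. *)
pose c : R := (2 ^+ n * cnorm e)^-1.
have c0 : 0 < c by rewrite invr_gt0 mulr_gt0// exprn_gt0.
have small : coset_norm (tilde actF theta (c%:C%C *: e) nu) < n%:R.
  rewrite ltNge; apply/negP => big; apply: nuT.
  have nuN : nu \in nonzero_locus actF theta by exact/mem_set.
  exists (SigSub nuN) => //; exists (c%:C%C *: e) => //.
  by rewrite cnormZ cnorm_real_complex gtr0_norm// /c invfM divfK ?gt_eqF// exprVn.
rewrite /tilde linearZZ in small.
have c0C : c%:C%C != 0 :> R[i] by rewrite gt_eqF// ltcR.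
have := coset_normZ_ge (K0 nu) (KZ nu) (theta e) c0C.
rewrite cnorm_real_complex gtr0_norm// => /le_lt_trans/(_ small).
rewrite mulrC ltr_pdivrMr ?mulr_gt0 ?exprn_gt0// => /ltW/le_trans; apply.
by rewrite mulrA ler_wpM2r ?cnorm_ge0// lerDl.
Qed.
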